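(* Let $H$ be a $3$-uniform hypergraph on $n\ge 10$ vertices that contains no linear cycle. Then $H$ has a vertex whose degree is at most $n-2$.
   Context: A $3$-uniform hypergraph $H=(V,E)$ consists of a (finite) vertex set $V$ and a set $E$ of hyperedges, each hyperedge being a $3$-element subset of $V$. The degree of a vertex $v$ is the number of hyperedges of $H$ containing $v$. A linear cycle of length $k\ge 3$ is an alternating sequence $v_1,h_1,v_2,h_2,\ldots,v_k,h_k$ of distinct vertices and distinct hyperedges such that $h_i\cap h_{i+1}=\{v_{i+1}\}$ for each $i\in\{1,\ldots,k-1\}$, $h_1\cap h_k=\{v_1\}$, and $h_i\cap h_j=\emptyset$ whenever $1<|j-i|<k-1$. *)

(* Defs.v *)
From mathcomp Require Import all_boot.

Set Implicit Arguments.
Unset Strict Implicit.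
Unset Printing Implicit Defensive.

Record hypergraph3 (V : finType) := Hypergraph3 {
  hyperedges : {set {set V}};
  hyperedges_card : forall e, e \in hyperedges -> #|e| = 3
}.

Definition degree (V : finType) (H : hypergraph3 V) (x : V) : nat :=
  #|[set e in hyperedges H | x \in e]|.

(* Indices are shifted by one: [v i] and [h i], for i : 'I_k, are the vertex
   v_{i+1} and the hyperedge h_{i+1}.  In the last clause, [j - i] is the
   truncated difference, so that [1 < j - i] forces i < j; this covers every
   pair of indices at distance strictly between 1 and k - 1 because [:&:] is
   commutative. *)
Definition linear_cycle (V : finType) (H : hypergraph3 V) (k : nat)
    (v : 'I_k -> V) (h : 'I_k -> {set V}) : Prop :=
  [/\ 3 <= k,
      injective v /\ injective h,
      forall i, h i \in hyperedges H,
      (forall i j : 'I_k, j = i.+1 :> nat -> h i :&: h j = [set v j]) /\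
      (forall i j : 'I_k, i = 0 :> nat -> j = k.-1 :> nat ->
         h i :&: h j = [set v i])
    & forall i j : 'I_k, 1 < j - i < k.-1 -> h i :&: h j = set0].

Definition has_linear_cycle (V : finType) (H : hypergraph3 V) : Prop :=
  exists (k : nat) (v : 'I_k -> V) (h : 'I_k -> {set V}), linear_cycle H v h.

(* Main.v *)
Require Import Defs.
From mathcomp Require Import all_boot.
From mathcomp Require Import zify.

(** Suppose that every degree is at least n - 1, where n is the number of
    vertices, and that there is no linear cycle.  A longest linear path
    h 0, ..., h (k - 1) is studied from its end edge h 0 = {x, y, z}, where x is
    the vertex shared with h 1.  Put P_i = h i minus h (i - 1), a pair.

    - An edge f through y that avoids x and z must be y together with some P_i
      (edge_at_free_vertex): if f misses the rest of the path it prolongs the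
      path, and if it meets the first h i that it touches in one vertex only it
      closes a linear cycle.  Hence, with A, B, C the sets of third vertices of
      the edges on xy, yz, xz other than xyz, and I the set of the i that give
      such an edge (spurs), deg y <= 1 + |A| + |B| + |I| (degree_bound).

    - Pairwise distinct a in A, b in B, c in C give a linear triangle.  The
      pairs P_i are disjoint, B avoids P_j for every j beyond the least element of I
      (no_chord_free), and A avoids P_i for i > 1 (no_chord_attach).  Counting
      vertices, with n >= 10 needed when A, B, C are all small, leaves only
      A empty, or C empty, or A = C = {w}, while B misses at most two vertices
      (others_trichotomy, free_pair_lower_bound).

    - An edge y + P_i permits a rotation: reversing h 0, ..., h (i - 1) and
      putting y + P_i in place of h i gives another longest path, to which the
      previous bound applies.  The large sets of third vertices at the two ends
      then supply a linear triangle, so I is empty as soon as |A| <= 1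
      (spurs_empty).

    - Now the degree bound is tight: A = C = {w}, B is everything, and every
      edge at y meets {x, z} (path_end_structure).  So, if {x', y, z} with x' <> x
      ends another longest path, attached at x', then x' = w
      (attach_in_others).  As yz forms an edge with every vertex, such paths can
      be built with two different vertices x', a contradiction. *)

Set Implicit Arguments.
Unset Strict Implicit.
Unset Printing Implicit Defensive.

(** * Triples and linear cycles *)

Section LinearCycleFree.

Variables (V : finType) (H : hypergraph3 V).
Implicit Types (h : nat -> {set V}) (f e : {set V}).

Local Notation E := (hyperedges H).
Local Notation n := #|V|.

Definition edge (u v w : V) : bool := [set u; v; w] \in E.

Lemma edge_swap12 u v w : edge u v w = edge v u w.
Proof. by rewrite /edge (setUC [set u]). Qed.

Lemma edge_swap23 u v w : edge u v w = edge u w v.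
Proof. by rewrite /edge -!setUA (setUC [set v]). Qed.

Lemma edge_neq u v w : edge u v w -> [/\ u != v, u != w & v != w].
Proof.
move=> /hyperedges_card; rewrite -setUA !cardsU1 cards1 !inE negb_or.
by case: (u == v); case: (u == w); case: (v == w).
Qed.

Lemma triples_meet1 (u a a' b b' : V) : uniq [:: u; a; a'; b; b'] ->
  [set u; a; a'] :&: [set u; b; b'] = [set u].
Proof.
move=> uniq5; apply/setP=> t; rewrite !inE.
have [->|tu] := eqVneq t u => //=; apply/negbTE/negP.
by case/andP=> /orP[]/eqP-> /orP[]/eqP eq_ab; move: uniq5;
  rewrite /= !inE eq_ab !eqxx ?orbT /= ?andbF.
Qed.

Lemma edgeP f : f \in E -> forall y, y \in f ->
  exists u v, f = [set y; u; v] /\ edge y u v.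
Proof.
move=> fE y yf; have := hyperedges_card fE.
rewrite (cardsD1 y) yf add1n => -[] /eqP /cards2P[u [v [_ fyE]]].
exists u, v; suff fE' : f = [set y; u; v] by rewrite /edge -fE'.
by rewrite -(setD1K yf) fyE setUA.
Qed.

(** Indexing the edges by natural numbers, with the intersections recorded by
    their cardinals, avoids carrying the vertices along.  The last hypothesis
    excludes, for m = 3, three edges through one common vertex, which the
    cardinals alone would allow. *)
Lemma linear_cycle_of_nat (c : nat -> {set V}) m : 2 < m ->
    (forall i, i < m -> c i \in E) ->
    (forall i j, i < j < m ->
       #|c i :&: c j| = ((j == i.+1) || (i == 0) && (j == m.-1))) ->
    (forall u, u \in c 0 -> u \in c 1 -> u \in c 2 -> False) ->
  has_linear_cycle H.
Proof.
move=> m_gt2 cE cI c012.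
have far i j u : i < m -> j < m -> u \in c i -> u \in c j ->
    [|| i == j, j == i.+1, i == j.+1,
        (i == 0) && (j == m.-1) | (j == 0) && (i == m.-1)].
  wlog le_ij : i j / i <= j.
    move=> wl im jm ui uj; have [le_ij|/ltnW le_ji] := leqP i j.
      exact: wl.
    by have := wl j i le_ji jm im uj ui; lia.
  move=> im jm ui uj; have := cI i j; rewrite jm andbT.
  have [ltij /(_ isT)|] := ltnP i j; last by lia.
  have : 0 < #|c i :&: c j| by apply/card_gt0P; exists u; rewrite inE ui.
  by move=> /[swap] -> ; lia.
pose p (i : nat) := if i is i'.+1 then i' else m.-1.
have [v vP] : exists v : 'I_m -> V,
    forall i : 'I_m, c (p i) :&: c i = [set v i].
  apply: (@fin_all_exists _ (fun=> V)
    (fun (i : 'I_m) u => c (p i) :&: c i = [set u])).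
  case=> -[|i] ltim /=; apply/cards1P/eqP.
    rewrite setIC (cI 0 m.-1) ?eqxx ?orbT //; lia.
  by rewrite cI ?eqxx //; lia.
have vc (i : 'I_m) : v i \in c i.
  by have /setP/(_ (v i)) := vP i; rewrite !inE eqxx => /andP[].
have vp (i : 'I_m) : v i \in c (p i).
  by have /setP/(_ (v i)) := vP i; rewrite !inE eqxx => /andP[].
(* A vertex chosen twice would lie in c (i - 1), c i, c (j - 1) and c j, which
   leaves no room unless m = 3. *)
have v_neq (i j : 'I_m) : i < j -> v i <> v j.
  move=> ltij; have ltjm := ltn_ord j => vij.
  have u1 := vc i; have u2 := vp i; have u3 := vc j; have u4 := vp j.
  rewrite -vij in u3 u4; move: (v i) u1 u2 u3 u4 => u {vij}.
  move: (nat_of_ord i) (nat_of_ord j) ltij ltjm => {v vP vc vp i j} i j ltij ltjm.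
  move=> u1 u2 u3 u4.
  have pi : p i < m by rewrite /p; case: (i) ltij; lia.
  have pj : p j < m by rewrite /p; case: (j) ltjm; lia.
  have im := ltn_trans ltij ltjm.
  have f1 := far _ _ _ im ltjm u1 u3; have f2 := far _ _ _ im pj u1 u4.
  have f3 := far _ _ _ pi ltjm u2 u3; have f4 := far _ _ _ pi pj u2 u4.
  have m3 : m = 3.
    by case: i j ltij ltjm {u1 u2 u3 u4 im pi pj} f1 f2 f3 f4
      => [|i] [|j] //=; lia.
  move: m3 ltij ltjm u1 u2 u3 u4 => {f1 f2 f3 f4 im pi pj}; rewrite /p => ->.
  case: i => [|[|[|i]]]; case: j => [|[|[|j]]] //= _ _ *; exact: (c012 u).
have c_inj (i j : 'I_m) : i < j -> c i <> c j.
  move=> ltij cij; have := hyperedges_card (cE i (ltn_ord i)).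
  have := cI i j; rewrite ltij ltn_ord => /(_ isT).
  by rewrite -cij setIid => ->; case: (_ || _).
exists m, v, (fun i => c i); split=> //.
- split=> i j eqij; apply/val_inj; case: (ltngtP i j) => // lt_ij.
  + by case: (v_neq _ _ lt_ij).
  + by case: (v_neq _ _ lt_ij).
  + by case: (c_inj _ _ lt_ij).
  + by case: (c_inj _ _ lt_ij).
- by move=> i; apply: cE.
- split=> i j; first by move=> eji; rewrite -vP eji.
  by move=> i0 jm; rewrite -vP i0 /= jm setIC.
- move=> i j ijm; apply/eqP; rewrite -cards_eq0 cI; first by lia.
  have := ltn_ord j; lia.
Qed.

(** * Linear paths *)

Definition linear_path h k :=
  (forall i, i < k -> h i \in E) /\
  (forall i j, i < j < k -> #|h i :&: h j| = (j == i.+1)).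

Lemma path_meet h k i j u : linear_path h k -> i < k -> j < k ->
  u \in h i -> u \in h j -> i <= j.+1.
Proof.
move=> [_ hI] ik jk ui uj; rewrite leqNgt; apply/negP=> ltji.
have := hI j i; rewrite ik (ltn_trans _ ltji) // => /(_ isT).
have -> : (i == j.+1) = false by apply/negbTE; rewrite gtn_eqF.
by move/eqP; rewrite cards_eq0 => /eqP/setP/(_ u); rewrite !inE ui uj.
Qed.

Lemma path_joint h k i : linear_path h k -> i.+1 < k ->
  exists u, h i :&: h i.+1 = [set u].
Proof. by move=> [_ hI] ik; apply/cards1P; rewrite hI ?eqxx // ltnSn. Qed.

Lemma subpath h k a m : linear_path h k -> a + m <= k ->
  linear_path (fun t => h (a + t)) m.
Proof.
move=> [hE hI] amk; split=> [i im|i j ijm]; first by apply: hE; lia.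
by rewrite hI ?addnS -?addnS ?eqn_add2l //; lia.
Qed.

Hypothesis acyclic : ~ has_linear_cycle H.

Lemma no_triangle u v w a b c :
  edge u v a -> edge v w b -> edge u w c -> uniq [:: u; v; w; a; b; c] -> False.
Proof.
move=> e1 e2 e3 uniq6; apply: acyclic.
pose d (i : nat) := match i with
  0 => [set u; v; a] | 1 => [set v; w; b] | _ => [set u; w; c] end.
have perm s : perm_eq s [:: u; v; w; a; b; c] -> uniq (take 5 s).
  by move/perm_uniq=> eq_s; apply: take_uniq; rewrite eq_s.
have I1 : d 0 :&: d 1 = [set v].
  rewrite /= (setUC [set u]); apply: triples_meet1.
  by apply: (perm [:: v; u; a; w; b; c]); apply/permP=> q /=; clear; lia.
have I2 : d 0 :&: d 2 = [set u].
  apply: triples_meet1.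
  by apply: (perm [:: u; v; a; w; c; b]); apply/permP=> q /=; clear; lia.
have I3 : d 1 :&: d 2 = [set w].
  rewrite /= (setUC [set v]) (setUC [set u]); apply: triples_meet1.
  by apply: (perm [:: w; v; b; u; c; a]); apply/permP=> q /=; clear; lia.
apply: (@linear_cycle_of_nat d 3) => //.
- by case=> [|[|[|]]].
- by case=> [|[|[|i]]] [|[|[|j]]] //; rewrite ?I1 ?I2 ?I3 ?cards1 // => ?; lia.
- move=> t t0 t1 t2; have : t \in d 0 :&: d 1 by rewrite inE t0.
  have : t \in d 0 :&: d 2 by rewrite inE t0.
  rewrite I1 I2 !inE => /eqP-> /eqP uv.
  by move: uniq6; rewrite /= uv !inE eqxx.
Qed.

(** A linear path and an edge meeting it exactly at one vertex of each end edge
    form a linear cycle; the last hypothesis excludes, for m = 2, that the edge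
    passes through the joint of the two edges of the path. *)
Lemma no_closing_edge h m f : 1 < m -> linear_path h m -> f \in E ->
  #|f :&: h 0| = 1 -> #|f :&: h m.-1| = 1 ->
  (forall t u, 0 < t < m.-1 -> u \in f -> u \in h t -> False) ->
  (forall u, u \in f -> u \in h 0 -> u \in h 1 -> False) -> False.
Proof.
move=> m_gt1 hP fE f0 fm fmid f01; apply: acyclic; case: (hP) => hE hI.
apply: (@linear_cycle_of_nat (fun t => if t < m then h t else f) m.+1) => //.
- by move=> i _; case: ifP => // /hE.
- move=> i j /andP[ltij]; rewrite ltnS leq_eqVlt => /orP[/eqP jm|ltjm]; last first.
    rewrite ltjm (ltn_trans ltij ltjm) hI ?ltij //=.
    have -> : (j == m) = false by lia.
    by rewrite andbF orbF.
  rewrite jm in ltij *; rewrite ltnn ltij.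
  rewrite /= eqxx andbT setIC; have [->|i0] := posnP i.
    by rewrite f0 orbT.
  have [->|im] := eqVneq i m.-1.
    by rewrite fm; have -> : m == m.-1.+1 by lia.
  have -> : (m == i.+1) = false by lia.
  apply/eqP; rewrite cards_eq0; apply/eqP/setP=> u; rewrite !inE.
  apply/negbTE/negP=> /andP[uf ui]; apply: (fmid i u) => //; lia.
- move=> u; have -> /= : 0 < m by lia.
  rewrite m_gt1 => u0 u1; case: ifP => [m_gt2 u2|_ uf]; last exact: (f01 u).
  by have := path_meet hP m_gt2 (ltnW m_gt1) u2 u0.
Qed.


(** * The end of a path *)

(** Paths are numbered from the end under study.  The vertex x is where the end
    edge is attached, y and z are its free vertices; when k = 1 the choice of x
    is arbitrary. *)
Definition path_end h k x y z :=
  [/\ linear_path h k, 0 < k, h 0 = [set x; y; z] & 1 < k -> x \in h 1].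

(** For 0 < i < k this is the pair P_i.  It contains the joint with h i.+1, and
    the pairs for distinct i are disjoint. *)
Definition outer h i := h i :\: h i.-1.

Definition others (u v w : V) := [set b | (b != w) && edge u v b].

Lemma othersC u v w : others u v w = others v u w.
Proof. by apply/setP=> b; rewrite !inE edge_swap12. Qed.

Section PathEnd.

Variables (k : nat) (h : nat -> {set V}) (x y z : V).
Hypothesis hP : path_end h k x y z.

Lemma end_swap : path_end h k x z y.
Proof.
by case: hP => lh k0 h0 x1; split=> //; rewrite h0 -!setUA (setUC [set y]).
Qed.

Lemma end_edge : edge x y z.
Proof. by case: hP => -[hE _] k0 h0 _; rewrite /edge -h0 hE. Qed.

Lemma end_y0 : y \in h 0.
Proof. by case: hP => _ _ -> _; rewrite !inE eqxx orbT. Qed.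

Lemma end_attach_notin i : 1 < i < k -> x \notin h i.
Proof.
case: hP => lh k0 h0 x1 /andP[i1 ik]; apply/negP=> xi.
have x0 : x \in h 0 by rewrite h0 !inE eqxx.
by have := path_meet lh ik k0 xi x0; rewrite leqNgt i1.
Qed.

Lemma end_free_notin i : 0 < i < k -> y \notin h i.
Proof.
case: hP => lh k0 h0 x1 /andP[i0 ik]; apply/negP=> yi.
have i1 : i = 1 by apply/eqP; rewrite eqn_leq i0 (path_meet lh ik k0 yi end_y0).
subst i; have [u uE] := path_joint lh ik; have [/eqP xy _ _] := edge_neq end_edge.
apply: xy; have /setP/(_ x) := uE; have /setP/(_ y) := uE.
by rewrite !inE yi end_y0 x1 // h0 !inE eqxx => /esym/eqP-> /esym/eqP.
Qed.

End PathEnd.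

Lemma end_meet h k x y z f : path_end h k x y z -> y \in f -> x \notin f ->
  z \notin f -> f :&: h 0 = [set y].
Proof.
case=> _ _ -> _ yf xf zf; apply/setP=> u; rewrite !inE.
by have [->|uy] := eqVneq u y; rewrite ?yf ?orbT //= orbF;
  apply/negbTE/negP=> /andP[uf /orP[]/eqP eu]; move: uf;
    rewrite eu ?(negbTE xf) ?(negbTE zf).
Qed.

Section Outer.

Variables (k : nat) (h : nat -> {set V}) (x y z : V).
Hypothesis hP : path_end h k x y z.

Let lh : linear_path h k. Proof. by case: hP. Qed.

Lemma card_outer i : 0 < i < k -> #|outer h i| = 2.
Proof.
case: i => // i /= ik; rewrite /outer /= cardsD setIC.
by case: lh => hE hI; rewrite (hyperedges_card (hE _ ik)) hI ?eqxx // ltnSn.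
Qed.

Lemma outer_sub i u : u \in outer h i -> u \in h i.
Proof. by rewrite inE => /andP[]. Qed.

Lemma outer_below i j u : i < k -> j < i -> u \in outer h i -> u \notin h j.
Proof.
move=> ik ji; rewrite inE => /andP[ui1 ui]; apply/negP=> uj.
have := path_meet lh ik (ltn_trans ji ik) ui uj => ij.
by case/negP: ui1; have -> : i.-1 = j by lia.
Qed.

Lemma outer_inj i j u : i < k -> j < k ->
  u \in outer h i -> u \in outer h j -> i = j.
Proof.
move=> ik jk ui uj; case: (ltngtP i j) => // [ij|ji].
  by case/negP: (outer_below jk ij uj); apply: outer_sub.
by case/negP: (outer_below ik ji ui); apply: outer_sub.
Qed.

Lemma outer_end i u : 0 < i < k -> u \in outer h i -> [/\ u != x, u != y & u != z].
Proof.
move=> /andP[i0 ik] ui; have := outer_below ik i0 ui; case: hP => _ _ -> _.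
by rewrite !inE !negb_or -andbA => /and3P.
Qed.

Lemma outer_triple i r : 0 < i < k -> r \in outer h i -> exists t s,
  [/\ h i = [set t; r; s], outer h i = [set r; s], t \in h i.-1 & edge t r s].
Proof.
move=> ik ri; have [s oE] : exists s, outer h i = [set r; s].
  have := card_outer ik; rewrite (cardsD1 r) ri add1n => -[] /eqP/cards1P[s sE].
  by exists s; rewrite -sE setD1K.
have [t tE] : exists t, h i.-1 :&: h i = [set t].
  by have := path_joint (i := i.-1) lh; rewrite prednK; [apply|]; lia.
have hE : h i = [set t; r; s].
  by rewrite -(setID (h i) (h i.-1)) setIC tE -[h i :\: _]/(outer h i) oE setUA.
exists t, s; split=> //.
  by have /setP/(_ t) := tE; rewrite !inE eqxx => /andP[].
by rewrite /edge -hE; case: lh => hE' _; apply: hE'; lia.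
Qed.

Lemma joint_outer i u : 0 < i -> i.+1 < k ->
  u \in h i -> u \in h i.+1 -> u \in outer h i.
Proof.
move=> i0 ik ui ui1; rewrite inE ui andbT; apply/negP=> uim.
have := path_meet lh ik _ ui1 uim; lia.
Qed.

End Outer.

(** * Edges that would close a cycle *)

Lemma card_singleton (X : {set V}) u : X = [set u] -> #|X| = 1.
Proof. by move->; rewrite cards1. Qed.

(** The path h 1, ..., h i and the edge {x, y, a} form a linear cycle; for i = 1
    they would not, since that cycle would have only two edges. *)
Lemma no_chord_attach h k x y z i a : path_end h k x y z -> 1 < i < k ->
  a \in outer h i -> edge x y a -> False.
Proof.
move=> hP /andP[i1 ik] ai xya; have [lh k0 h0 x1] := hP.
have k1 : 1 < k by apply: ltn_trans ik.
have li : linear_path (fun t => h (1 + t)) i by apply: subpath lh _.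
have y_out t : 0 < t < k -> y \notin h t := end_free_notin hP (i := t).
have x_out t : 1 < t < k -> x \notin h t := end_attach_notin hP (i := t).
have a_out t : t < i -> a \notin h t by move=> ti; apply: (outer_below hP ik ti ai).
apply: (no_closing_edge i1 li xya).
- apply: (@card_singleton _ x); apply/setP=> u; rewrite !inE.
  have [->|_] := eqVneq u x; first by rewrite x1.
  by apply/negbTE/negP=> /andP[/orP[]/eqP->]; apply/negP;
    [apply: y_out | apply: a_out].
- apply: (@card_singleton _ a); apply/setP=> u; rewrite !inE.
  have -> : 1 + i.-1 = i by lia.
  have [->|_] := eqVneq u a; first by rewrite orbT (outer_sub ai).
  rewrite orbF; apply/negbTE/negP=> /andP[/orP[]/eqP->]; apply/negP.
    by apply: x_out; rewrite i1.
  by apply: y_out; lia.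
- move=> t u ti; rewrite !inE => /orP[/orP[]|] /eqP->; apply/negP.
  + apply: x_out; lia.
  + apply: y_out; lia.
  + apply: a_out; lia.
- move=> u; rewrite !inE => /orP[/orP[]|] /eqP-> u1 u2.
  + by move: u2; apply/negP/x_out; lia.
  + by move: u2; apply/negP/y_out; lia.
  + by move: u1; apply/negP/a_out; lia.
Qed.

(** The path h (i - 1), ..., h 0, f, h (i + 1), ...: when f is y together with
    outer h i, it meets h 0 in y and h i.+1 in the same vertex as h i does. *)
Definition rotation h i f j :=
  if j < i then h (i.-1 - j) else if j == i then f else h j.

Lemma rotation_linear h k x y z i : path_end h k x y z -> 0 < i < k ->
  y |: outer h i \in E -> linear_path (rotation h i (y |: outer h i)) k.
Proof.
move=> hP ik fE; have [[hE hI] k0 h0 x1] := hP.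
have lh : linear_path h k by [].
have y_out t : 0 < t < k -> y \notin h t := end_free_notin hP (i := t).
split=> [j jk|a b /andP[ab bk]].
  rewrite /rotation; case: ifP => _; first by apply: hE; lia.
  by case: ifP => // _; apply: hE.
rewrite /rotation.
case: (ltngtP b i) => [bi|ib|eb].
- rewrite (ltn_trans ab bi) setIC hI; last by lia.
  by congr (nat_of_bool _); lia.
- case: (ltngtP a i) => [ai|ia|eai].
  + have -> : (b == a.+1) = false by lia.
    by rewrite hI; [congr (nat_of_bool _)|]; lia.
  + by rewrite hI // ab.
  + subst a; have -> : (y |: outer h i) :&: h b = h i :&: h b.
      apply/setP=> u; rewrite !inE.
      have [->|_] := eqVneq u y.
        by rewrite (negbTE (y_out b _)) ?andbF //; lia.
      rewrite /= -andbA; case ui1: (u \in h i.-1) => //=.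
      case ub: (u \in h b); rewrite ?andbF //.
      by have := path_meet lh bk _ ub ui1; lia.
    by rewrite hI // ab.
- subst b; rewrite ab; have [xy _ yz] := edge_neq (end_edge hP).
  have [a1|a1] := eqVneq i a.+1.
    have -> : i.-1 - a = 0 by lia.
    rewrite setIC (card_singleton (end_meet hP _ _ _)) ?setU11 // in_setU1 negb_or.
      by rewrite xy; apply/negP=> /(outer_end hP ik)[]; rewrite eqxx.
    by rewrite eq_sym yz; apply/negP=> /(outer_end hP ik)[_ _]; rewrite eqxx.
  apply/eqP; rewrite cards_eq0; apply/eqP/setP=> u; rewrite in_setI in_setU1 in_set0.
  apply/negbTE/negP=> /andP[ut /orP[/eqP uy|ui]]; move: ut; apply/negP.
    by rewrite uy; apply: y_out; lia.
  by apply: (outer_below hP _ _ ui); lia.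
Qed.

(** In the rotated path, the part from y |: outer h i to h j is closed by the
    edge {y, z, b}. *)
Lemma no_chord_free h k x y z i j b : path_end h k x y z -> 0 < i < j -> j < k ->
  y |: outer h i \in E -> b \in outer h j -> edge y z b -> False.
Proof.
move=> hP /andP[i0 ij] jk fE bj yzb.
have ik : 0 < i < k by lia.
have y_out t : 0 < t < k -> y \notin h t := end_free_notin hP (i := t).
have z_out t : 0 < t < k -> z \notin h t := end_free_notin (end_swap hP) (i := t).
have b_out t : t < j -> b \notin h t by move=> tj; apply: (outer_below hP jk tj bj).
have zf : z \notin y |: outer h i.
  have [_ _ yz] := edge_neq (end_edge hP).
  rewrite in_setU1 negb_or eq_sym yz; apply/negP=> /(outer_end hP ik)[_ _].
  by rewrite eqxx.
have bf : b \notin y |: outer h i.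
  have [_ /eqP by_ _] := edge_neq yzb.
  rewrite in_setU1 negb_or eq_sym; apply/andP; split; first by apply/eqP.
  by apply/negP=> /outer_sub; apply/negP/b_out.
pose g t := rotation h i (y |: outer h i) (i + t).
have gP : linear_path g (j - i).+1.
  by apply: subpath (rotation_linear hP ik fE) _; lia.
have g0 : g 0 = y |: outer h i by rewrite /g /rotation addn0 ltnn eqxx.
have gS t : 0 < t -> g t = h (i + t).
  move=> t0; rewrite /g /rotation.
  by have [-> ->] : (i + t < i) = false /\ (i + t == i) = false by lia.
have gj : g (j - i) = h j by rewrite gS ?subnKC //; lia.
apply: (no_closing_edge _ gP yzb) => [|||t u ti uf|u uf].
- lia.
- apply: (@card_singleton _ y); apply/setP=> u; rewrite in_setI g0 !inE -!orbA.
  have [->|uy] := eqVneq u y => //=; apply/negbTE/negP=> /andP[/orP[]/eqP-> uo].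
    by case/negP: zf; rewrite in_setU1 inE uo orbT.
  by case/negP: bf; rewrite in_setU1 inE uo orbT.
- apply: (@card_singleton _ b); rewrite gj; apply/setP=> u; rewrite !inE.
  have [->|ub] := eqVneq u b; first by rewrite orbT (outer_sub bj).
  rewrite orbF; apply/negbTE/negP=> /andP[/orP[]/eqP->]; apply/negP.
    by apply: y_out; lia.
  by apply: z_out; lia.
- rewrite gS; last by lia.
  move: uf; rewrite !inE -orbA => /or3P[] /eqP->; apply/negP.
  + by apply: y_out; lia.
  + by apply: z_out; lia.
  + by apply: b_out; lia.
- rewrite g0 gS // => u0 u1; move: uf; rewrite !inE -orbA => /or3P[] /eqP eu.
  + by move: u1; rewrite eu; apply/negP/y_out; lia.
  + by move: u0; rewrite eu; apply/negP.
  + by move: u0; rewrite eu; apply/negP.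
Qed.

(** * Longest paths under the degree condition *)

Section Longest.

Variable k : nat.
Hypothesis no_longer : forall h, ~ linear_path h k.+1.

(** Take the first h i, i > 0, that f meets.  There is one, or f would prolong
    the path; f meets it in two vertices, or h 0, ..., h i and f would form a
    linear cycle; and these two vertices are not in h i.-1. *)
Lemma edge_at_free_vertex h x y z f : path_end h k x y z -> f \in E -> y \in f ->
  x \notin f -> z \notin f -> exists2 i, 0 < i < k & f = y |: outer h i.
Proof.
move=> hP fE yf xf zf; have [[hE hI] k0 h0 x1] := hP.
have lh : linear_path h k by [].
have f0 := end_meet hP yf xf zf.
have y_out t : 0 < t < k -> y \notin h t := end_free_notin hP (i := t).
have [i0 meet_i0|noi] := pickP (fun i : 'I_k => (0 < i) && (f :&: h i != set0));
  last first.
  case: (no_longer (h := fun j => if j is j'.+1 then h j' else f)); split.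
    by case=> // j; apply: hE.
  case=> [|i] [|j] //; last by rewrite ltnS => ijk; rewrite hI // eqSS.
  rewrite ltnS => /= jk; case: j jk => [|j] jk; first by rewrite (card_singleton f0).
  have := noi (Ordinal (jk : j.+1 < k)); rewrite /= => /negbFE/eqP->; exact: cards0.
have : exists i, (0 < i < k) && (f :&: h i != set0).
  by exists i0; rewrite ltn_ord andbT.
case/ex_minnP=> i /andP[ik meet_i] i_min; exists i => //.
have f_in t u : 0 < t < i -> u \in f -> u \in h t -> False.
  move=> ti uf ut; suff : i <= t by case/andP: ti => _; rewrite ltnNge => /negbTE->.
  apply: i_min; apply/andP; split; first by move: ti ik; clear; lia.
  by apply/set0Pn; exists u; rewrite inE uf.
have sub : f :&: h i \subset f :\ y.
  apply/subsetP=> u; rewrite !inE => /andP[-> ui]; rewrite andbT.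
  by apply: contraTneq ui => ->; apply: y_out.
have cfy : #|f :\ y| = 2.
  by have := hyperedges_card fE; rewrite (cardsD1 y) yf => -[].
have : #|f :&: h i| <= 2 by rewrite -cfy subset_leq_card.
rewrite leq_eqVlt => /orP[/eqP ci|ci]; last first.
  have {ci meet_i} ci : #|f :&: h i| = 1.
    by apply/eqP; rewrite eqn_leq -ltnS ci card_gt0.
  have li : linear_path (fun t => h (0 + t)) i.+1 by apply: subpath lh _; lia.
  exfalso; apply: (no_closing_edge _ li fE) => //.
  - by case/andP: ik.
  - exact: card_singleton f0.
  - move=> u uf u0 u1; have : u \in f :&: h 0 by rewrite inE uf.
    rewrite f0 inE => /eqP uy; move: u1; rewrite uy; apply/negP/y_out.
    by move: ik; clear; lia.
have fyi : f :&: h i = f :\ y by apply/eqP; rewrite eqEcard sub cfy ci.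
rewrite -(setD1K yf); congr (_ |: _); apply/eqP.
rewrite eqEcard cfy (card_outer hP ik) leqnn andbT; apply/subsetP=> u uf.
have := uf; rewrite -fyi => /setIP[uf' ui]; rewrite inE ui andbT.
apply/negP=> uim; have [i1|i1] := posnP i.-1; last first.
  by apply: (f_in i.-1 u) => //; move: ik i1; clear; lia.
have : u \in f :&: h 0 by rewrite inE uf' -i1.
by rewrite f0 inE => /eqP uy; move: uf; rewrite uy !inE eqxx.
Qed.

Hypothesis n_ge10 : 10 <= n.
Hypothesis min_degree : forall v, n - 1 <= degree H v.

(** By edge_at_free_vertex these indices account for all edges at y that avoid
    the other two vertices of the end edge. *)
Definition spurs h y : {set 'I_k} :=
  [set i : 'I_k | (0 < i) && (y |: outer h i \in E)].

Lemma edge_through f u v : f \in E -> u \in f -> v \in f -> u != v ->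
  exists b, f = [set u; v; b].
Proof.
move=> fE uf vf uv; have [a [b [fE' _]]] := edgeP fE uf.
move: vf; rewrite fE' !inE eq_sym (negbTE uv) /= => /orP[]/eqP->; first by exists b.
by exists a; rewrite -!setUA (setUC [set a]).
Qed.

Lemma degree_bound h x y z : path_end h k x y z ->
  n - 1 <= #|others x y z| + #|others y z x| + #|spurs h y| + 1.
Proof.
move=> hP; apply: leq_trans (min_degree y) _; rewrite /degree.
have [xy xz yz] := edge_neq (end_edge hP).
pose F1 := (fun b => [set x; y; b]) @: others x y z.
pose F2 := (fun b => [set y; z; b]) @: others y z x.
pose F3 := (fun i : 'I_k => y |: outer h i) @: spurs h y.
have sub : [set f in E | y \in f] \subset F1 :|: F2 :|: F3 :|: [set [set x; y; z]].
  apply/subsetP=> f; rewrite inE => /andP[fE yf]; rewrite !in_setU in_set1.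
  have [xf|xf] := boolP (x \in f).
    have [b fb] := edge_through fE xf yf xy.
    have [bz|bz] := eqVneq b z; first by rewrite fb bz eqxx orbT.
    apply/orP; left; apply/orP; left; apply/orP; left; rewrite fb; apply: imset_f.
    by rewrite inE bz /edge -fb.
  have [zf|zf] := boolP (z \in f).
    have [b fb] := edge_through fE yf zf yz.
    apply/orP; left; apply/orP; left; apply/orP; right; rewrite fb; apply: imset_f.
    rewrite inE /edge -fb fE andbT; apply: contraNneq xf => <-.
    by rewrite fb !inE eqxx orbT.
  have [i /andP[i0 ik] fi] := edge_at_free_vertex hP fE yf xf zf.
  apply/orP; left; apply/orP; right; apply/imsetP; exists (Ordinal ik) => //.
  by rewrite inE /= i0 -fi.
apply: leq_trans (subset_leq_card sub) _.
apply: leq_trans (leq_card_setU _ _) _; rewrite cards1 leq_add2r.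
apply: leq_trans (leq_card_setU _ _) _; apply: leq_add; last exact: leq_imset_card.
by apply: leq_trans (leq_card_setU _ _) _; apply: leq_add; exact: leq_imset_card.
Qed.

Lemma card_triple u v w : edge u v w -> #|[set u; v; w]| = 3.
Proof. exact: hyperedges_card. Qed.

(** The end edge, X and the pairs outer h i, i in I, are pairwise disjoint. *)
Lemma count_outer h x y z (X : {set V}) (I : {set 'I_k}) : path_end h k x y z ->
  [disjoint X & [set x; y; z]] ->
  (forall i : 'I_k, i \in I -> 0 < i /\ [disjoint X & outer h i]) ->
  #|X| + 2 * #|I| <= n - 3.
Proof.
move=> hP Xxyz XI.
pose F (i : 'I_k) := if i \in I then outer h i else set0.
have cM : #|\bigcup_i F i| = 2 * #|I|.
  rewrite -sum1_card partition_disjoint_bigcup => [|i j ij].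
    rewrite (bigID (mem I)) /= [X in _ + X]big1 => [|i]; last first.
      by rewrite /F => /negbTE->; rewrite big_set0.
    rewrite addn0 (eq_bigr (fun=> 2)) => [|i iI].
      by rewrite sum_nat_const mulnC.
    rewrite /F iI sum1_card (card_outer hP) //.
    by have [-> _] := XI i iI; rewrite ltn_ord.
  rewrite /F; case: ifP => _; last by rewrite disjoints_subset sub0set.
  case: ifP => _; last by rewrite disjoint_sym disjoints_subset sub0set.
  apply/pred0P=> u /=; apply/negbTE/negP=> /andP[ui uj].
  case/eqP: ij; apply/val_inj.
  exact: (outer_inj hP (ltn_ord i) (ltn_ord j) ui uj).
set M := \bigcup_i F i in cM.
have inM u : u \in M -> exists2 i : 'I_k, i \in I & u \in outer h i.
  by case/bigcupP=> i _; rewrite /F; case: ifP => [iI ui|]; [exists i|rewrite inE].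
have XM : X :&: M = set0.
  apply/setP=> u; rewrite !inE; apply/negbTE/negP=> /andP[uX /inM[i iI ui]].
  by have [_ /pred0P/(_ u)] := XI i iI; rewrite /= uX ui.
have XMxyz : (X :|: M) :&: [set x; y; z] = set0.
  rewrite setIUl (eqP (_ : X :&: _ == set0)) ?setI_eq0 // set0U.
  apply/setP=> u; rewrite in_setI in_set0; apply/negbTE/negP=> /andP[/inM[i iI ui]].
  have [i0 _] := XI i iI; have [] := outer_end hP _ ui; first by rewrite i0 /=.
  by rewrite !inE => /negbTE-> /negbTE-> /negbTE->.
have := subset_leq_card (subsetT (X :|: M :|: [set x; y; z])).
have := cardsUI (X :|: M) [set x; y; z]; have := cardsUI X M.
by rewrite cardsT XM XMxyz cards0 (card_triple (end_edge hP)) cM; lia.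
Qed.

Lemma no_distinct_others x y z a b c : edge x y z -> a \in others x y z ->
  b \in others y z x -> c \in others x z y -> a != b -> a != c -> b != c -> False.
Proof.
move=> xyz; rewrite !inE => /andP[az xya] /andP[bx yzb] /andP[cy xzc] ab ac bc.
apply: (no_triangle xya yzb xzc).
have [xy xz yz] := edge_neq xyz; have [_ xa ya] := edge_neq xya.
have [_ yb zb] := edge_neq yzb; have [_ xc zc] := edge_neq xzc.
by rewrite /= !inE !negb_or xy xz yz xa ya xc zc yb zb ab ac bc
  (eq_sym x b) (eq_sym y c) (eq_sym z a) az bx cy.
Qed.

Lemma others_disjoint u v w : [disjoint others u v w & [set u; v; w]].
Proof.
apply/pred0P=> b /=; rewrite !inE; apply/negbTE/negP=> /andP[/andP[bw /edge_neq[_]]].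
by rewrite eq_sym (eq_sym v) (negbTE bw) orbF => /negbTE-> /negbTE->.
Qed.

(** Here deg y is at most 5 + |I|, and 2 |I| <= n - 3 as the spurs use disjoint
    pairs; this is less than n - 1 as soon as n >= 10. *)
Lemma small_others h x y z : path_end h k x y z ->
  #|others x y z| <= 2 -> #|others y z x| <= 2 -> False.
Proof.
move=> hP A2 B2; have := degree_bound hP.
have := count_outer (X := set0) (I := spurs h y) hP _ _.
rewrite cards0 disjoints_subset sub0set => /(_ isT); move=> cnt.
suff : 0 + 2 * #|spurs h y| <= n - 3 by lia.
apply: cnt => i; rewrite inE => /andP[-> _]; split=> //.
by rewrite disjoints_subset sub0set.
Qed.

Lemma setC_triple x y z : edge x y z -> #|~: [set x; y; z]| = n - 3.
Proof. by move=> xyz; rewrite cardsCs setCK card_triple. Qed.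

Lemma others_full x y z : edge x y z -> n - 3 <= #|others x y z| ->
  forall b, b \notin [set x; y; z] -> edge x y b.
Proof.
move=> xyz An b bxyz.
have sub : others x y z \subset ~: [set x; y; z].
  by rewrite -disjoints_subset others_disjoint.
have /eqP/setP/(_ b) : others x y z == ~: [set x; y; z].
  by rewrite eqEcard sub setC_triple.
by rewrite in_setC bxyz inE => /andP[].
Qed.

(** No vertex of outer h i for a spur i > 1 is in others x y z, so each such
    spur costs two vertices and brings one edge.  Since y has degree at least
    n - 1 and no edge on yz besides the end edge, equality must hold
    throughout. *)
Lemma empty_free_pair h x y z : path_end h k x y z -> others y z x = set0 ->
  [/\ 1 < k, y |: outer h 1 \in E &
      forall a, a \notin [set x; y; z] -> edge x y a].
Proof.
move=> hP B0; have := degree_bound hP; rewrite B0 cards0.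
pose I1 := [set i in spurs h y | 1 < i].
have cnt : #|others x y z| + 2 * #|I1| <= n - 3.
  apply: (count_outer hP) => [|i]; first exact: others_disjoint.
  rewrite !inE => /andP[/andP[i0 _] i1]; split=> //.
  apply/pred0P=> a /=; apply/negbTE/negP=> /andP[]; rewrite !inE => /andP[_ xya] ai.
  by apply: (no_chord_attach hP _ _ xya (i := i)); rewrite ?i1 ?ltn_ord ?inE.
have [/existsP[i1 /andP[i1I /eqP i1E]]|no1] :=
  boolP [exists i : 'I_k, (i \in spurs h y) && (i == 1 :> nat)]; last first.
  have -> : spurs h y = I1.
    apply/setP=> i; rewrite [RHS]inE; case iI: (i \in _) => //=; apply/esym.
    have i0 : 0 < i by move: iI; rewrite inE => /andP[].
    rewrite ltn_neqAle i0 andbT; apply: contra no1 => /eqP i1.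
    by apply/existsP; exists i; rewrite iI -i1.
  lia.
have cI : #|spurs h y| <= #|I1| + 1.
  rewrite -(cards1 i1); apply: leq_trans (leq_card_setU _ _); apply: subset_leq_card.
  apply/subsetP=> i iI; rewrite in_setU in_set1 [i \in I1]inE iI /=.
  have i0 : 0 < i by move: iI; rewrite inE => /andP[].
  have [//|i_le1] := ltnP 1 i; apply/eqP/val_inj => /=; lia.
move=> deg; split.
- by have := ltn_ord i1; rewrite i1E.
- by move: i1I; rewrite inE i1E => /andP[].
- by apply: others_full (end_edge hP) _; lia.
Qed.

(** The disequalities at hand come in arbitrary orientation, so each one is
    also used with its sides exchanged. *)
Ltac distinct := rewrite /= ?inE ?negb_or;
  repeat match goal with N : is_true (?a != ?b) |- _ =>
    rewrite ?(eq_sym b a) ?N; clear N end; done.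

Lemma pick_avoiding (X : {set V}) u v : 2 < #|X| ->
  exists t, [/\ t \in X, t != u & t != v].
Proof.
move=> X3; have : 0 < #|X :\ u :\ v|.
  have := cardsD1 u X; have := cardsD1 v (X :\ u).
  by case: (u \in X); case: (v \in _); lia.
by case/card_gt0P=> t; rewrite !inE => /and3P[tv tu tX]; exists t.
Qed.

(** Otherwise the other two sets have more than two elements (small_others for
    y and for z), so distinct representatives would exist if others y z x were
    not empty.  When it is empty, empty_free_pair for y and z gives the
    linear triangle with corners x, y, p, where p is in outer h 1. *)
Lemma free_pair_gt2 h x y z : path_end h k x y z -> 2 < #|others y z x|.
Proof.
move=> hP; rewrite ltnNge; apply/negP=> B2; have hP' := end_swap hP.
have xyz := end_edge hP.
have A3 : 2 < #|others x y z|.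
  by rewrite ltnNge; apply/negP=> A2; apply: (small_others hP).
have C3 : 2 < #|others x z y|.
  by rewrite ltnNge; apply/negP=> C2; apply: (small_others hP' C2); rewrite othersC.
have B0 : others y z x = set0.
  have [//|[b bB]] := set_0Vmem (others y z x).
  have [a [aA ab _]] := pick_avoiding b b A3.
  have [c [cC cb ca]] := pick_avoiding b a C3.
  by case: (no_distinct_others xyz aA bB cC); rewrite // eq_sym.
have [k1 yE Afull] := empty_free_pair hP B0.
have [_ _ Cfull] : [/\ 1 < k, z |: outer h 1 \in E &
    forall c, c \notin [set x; z; y] -> edge x z c].
  by apply: empty_free_pair hP' _; rewrite othersC.
have /card_gt0P[p pi] : 0 < #|outer h 1| by rewrite (card_outer hP).
have [t [q [_ oE _ /edge_neq[_ _ pq]]]] := outer_triple hP (i := 1) k1 pi.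
have qi : q \in outer h 1 by rewrite oE !inE eqxx orbT.
have [px py pz] := outer_end hP (i := 1) k1 pi.
have [qx qy qz] := outer_end hP (i := 1) k1 qi; have [xy xz yz] := edge_neq xyz.
have [a [aA ap aq]] := pick_avoiding p q A3.
move: aA; rewrite inE => /andP[az xya]; have [_ xa ya] := edge_neq xya.
have ypq : edge y p q by rewrite /edge -setUA -oE.
have xpz : edge x p z by rewrite edge_swap23 Cfull // !inE !negb_or px py pz.
by apply: (no_triangle xya ypq xpz); distinct.
Qed.

(** Since others y z x has three elements, one of them differs from any given a
    and c, so that a <> c would yield distinct representatives. *)
Lemma others_trichotomy h x y z : path_end h k x y z ->
  [\/ others x y z = set0, others x z y = set0 |
      exists w, others x y z = [set w] /\ others x z y = [set w]].
Proof.
move=> hP; have B3 := free_pair_gt2 hP; have xyz := end_edge hP.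
have [->|[a aA]] := set_0Vmem (others x y z); first by constructor 1.
have [->|[c cC]] := set_0Vmem (others x z y); first by constructor 2.
have eq_others a' c' : a' \in others x y z -> c' \in others x z y -> a' = c'.
  move=> aA' cC'; apply/eqP/negPn/negP=> ac.
  have [b [bB ba bc]] := pick_avoiding a' c' B3.
  by apply: (no_distinct_others xyz aA' bB cC'); rewrite // eq_sym.
constructor 3; exists a; split; apply/eqP; rewrite eqEsubset sub1set.
  by rewrite aA andbT; apply/subsetP=> u /eq_others/(_ cC);
    rewrite (eq_others a c) // inE => ->.
rewrite (eq_others a c) // cC andbT; apply/subsetP=> u /(eq_others a u aA).
by rewrite (eq_others a c) // inE => ->.
Qed.

Lemma spur_lowest h y : spurs h y != set0 ->
  exists2 i, i \in spurs h y & forall j, j \in spurs h y -> i <= j.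
Proof. by case/set0Pn=> i0 i0I; case: (arg_minnP val i0I) => i; exists i. Qed.

Lemma spurs_above_disjoint h x y z (i j : 'I_k) : path_end h k x y z ->
  i \in spurs h y -> i < j -> [disjoint others y z x & outer h j].
Proof.
rewrite inE => hP /andP[i0 fE] ij; apply/pred0P=> b /=; apply/negbTE/negP.
case/andP; rewrite inE => /andP[_ yzb] bj.
by apply: (no_chord_free hP _ (ltn_ord j) fE bj yzb); rewrite i0.
Qed.

(** Every spur other than the least one is worth two vertices outside
    others y z x. *)
Lemma count_spurs h x y z (i : 'I_k) : path_end h k x y z -> i \in spurs h y ->
  (forall j, j \in spurs h y -> i <= j) ->
  #|others y z x| + 2 * #|spurs h y| <= n - 1.
Proof.
move=> hP iI imin.
have eqI : #|spurs h y| = 1 + #|spurs h y :\ i| by rewrite (cardsD1 i) iI.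
suff : #|others y z x| + 2 * #|spurs h y :\ i| <= n - 3 by lia.
apply: (count_outer hP) => [|j]; first
  by rewrite -setUA setUC others_disjoint.
rewrite !inE => /andP[ji jI]; split; first by case/andP: jI.
apply: (spurs_above_disjoint hP iI); rewrite ltn_neqAle eq_sym ji imin //.
by rewrite inE.
Qed.

(** One of y and z, say y, has |A| <= 1.  Its degree forces
    |B| + |I| >= n - 3, while |B| + 2 |I| <= n - 1 by count_spurs. *)
Lemma free_pair_lower_bound h x y z : path_end h k x y z ->
  n <= #|others y z x| + 5.
Proof.
have half x' y' z' : path_end h k x' y' z' -> #|others x' y' z'| <= 1 ->
    n <= #|others y' z' x'| + 5.
  move=> hP A1; have deg := degree_bound hP.
  have [I0|/spur_lowest[i iI imin]] := eqVneq (spurs h y') set0.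
    by move: deg; rewrite I0 cards0; lia.
  have := count_spurs hP iI imin; lia.
move=> hP; have hP' := end_swap hP.
have [A0|C0|[w [A1 _]]] := others_trichotomy hP.
- by apply: half; rewrite // A0 cards0.
- by rewrite othersC; apply: half; rewrite // C0 cards0.
- by apply: half; rewrite // A1 cards1.
Qed.

Lemma rotation_end1 h x y z : path_end h k x y z -> 1 < k ->
  y |: outer h 1 \in E -> path_end (rotation h 1 (y |: outer h 1)) k y x z.
Proof.
move=> hP k1 fE; split; first exact: (rotation_linear (i := 1) hP k1 fE).
- exact: ltnW.
- by case: hP => _ _ h0 _; rewrite /rotation /= h0 (setUC [set x]).
- by move=> _; rewrite /rotation /= setU11.
Qed.

Lemma rotation_end h x y z i t r s : path_end h k x y z -> 1 < i < k ->
  y |: outer h i \in E -> h i.-1 = [set t; r; s] -> t \in h i.-2 ->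
  path_end (rotation h i (y |: outer h i)) k t r s.
Proof.
move=> hP /andP[i1 ik] fE hE tE; have i0 : 0 < i by apply: ltnW.
split; first by apply: (rotation_linear hP _ fE); rewrite i0.
- exact: ltn_trans ik.
- by rewrite /rotation i0 subn0.
- by rewrite /rotation i1 subn1.
Qed.

Lemma card_avoiding (X : {set V}) (l : seq V) : uniq l ->
  {in l, forall v, v \notin X} -> #|X| + size l <= n.
Proof.
move=> ul lX; rewrite -(cardC [in X]) leq_add2l -(card_uniqP ul).
by apply: subset_leq_card; apply/subsetP=> v /lX.
Qed.

(** Let i be the least spur.  Some p in outer h i = {p, q} belongs to
    others y z x, or the count would be off by two.

    If i = 1, the rotated path ends with the same edge, attached at y, so xz is
    on many edges, and x, p, z are the corners of a linear triangle.

    If i > 1, the rotated path ends with h (i - 1), whose free pair {r, s} is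
    outer h i.-1, with r in h i.  By free_pair_lower_bound for that path, {r, s}
    forms an edge with one of y, z, p, q.  If it is y or z, it is with p and r
    the corners of a linear triangle, which uses h i = {r, p, q}.  If it is p or
    q, the edge y + {p, q} is used instead, and the third edge {y, z, d} has d
    in {r, s}; such a d exists because i - 1 is not a spur, so that outer h i.-1
    cannot be avoided by others y z x without breaking the count. *)
Lemma spurs_empty h x y z : path_end h k x y z -> #|others x y z| <= 1 ->
  spurs h y = set0.
Proof.
move=> hP A1; apply/eqP/negPn/negP=> /spur_lowest[i iI imin].
have deg := degree_bound hP; have xyz := end_edge hP.
have I_gt0 : 0 < #|spurs h y| by apply/card_gt0P; exists i.
have [xy xz yz] := edge_neq xyz.
have Bxyz : [disjoint others y z x & [set x; y; z]]
  by rewrite -setUA setUC others_disjoint.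
have /andP[i0 fE] : (0 < i) && (y |: outer h i \in E) by move: iI; rewrite inE.
have ik : 0 < i < k by rewrite i0 ltn_ord.
have [p pB pi] : exists2 p, p \in others y z x & p \in outer h i.
  have [BP|] := boolP [disjoint others y z x & outer h i]; last first.
    by case/pred0Pn=> p /= /andP[pB pi]; exists p.
  suff : #|others y z x| + 2 * #|spurs h y| <= n - 3
    by move: deg A1 I_gt0 n_ge10; clear; lia.
  apply: (count_outer hP) => // j jI.
  split; first by move: jI; rewrite inE => /andP[].
  have := imin j jI; rewrite leq_eqVlt => /orP[/eqP/val_inj <- //|].
  exact: (spurs_above_disjoint hP iI).
have /andP[_ yzp] : (p != x) && edge y z p by move: pB; rewrite inE.
have [r [q [hiE oiE rE rpq]]] := outer_triple hP ik pi.
have ri : r \in h i by rewrite hiE !inE eqxx.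
have qi : q \in outer h i by rewrite oiE !inE eqxx orbT.
have [px py pz] := outer_end hP ik pi; have [qx qy qz] := outer_end hP ik qi.
have [rp rq pq] := edge_neq rpq.
have ypq : edge y p q by rewrite /edge -setUA -oiE.
have [i1|i1] := eqVneq (i : nat) 1.
  (* h 1 = {x, p, q}: the corners are x, p, z *)
  rewrite i1 in ik fE rE ri.
  have rx : r = x.
    have y1 := end_free_notin hP ik; have z1 := end_free_notin (end_swap hP) ik.
    move: rE; case: hP => _ _ -> _; rewrite !inE -orbA => /or3P[] /eqP // re.
      by case/negP: y1; rewrite -re.
    by case/negP: z1; rewrite -re.
  rewrite rx in rp rq rpq.
  have k1 : 1 < k by case/andP: ik.
  have [c [cC cp cq]] := pick_avoiding p q (free_pair_gt2 (rotation_end1 hP k1 fE)).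
  move: cC; rewrite inE => /andP[cy xzc]; have [_ xc zc] := edge_neq xzc.
  have pzy : edge p z y by rewrite edge_swap12 edge_swap23 edge_swap12.
  by apply: (no_triangle rpq pzy xzc); distinct.
have i2 : 1 < i < k by rewrite ltn_ord andbT ltn_neqAle eq_sym i1 i0.
have ip : 0 < i.-1 < k by move: i2; clear; lia.
have rD : r \in outer h i.-1.
  apply: (joint_outer hP) => //; rewrite ?prednK //; by move: i2; clear; lia.
have [t [s [hpE opE tE trs]]] := outer_triple hP ip rD.
have sD : s \in outer h i.-1 by rewrite opE !inE eqxx orbT.
have B'n := free_pair_lower_bound (rotation_end hP i2 fE hpE tE).
have [rx ry rz] := outer_end hP ip rD; have [sx sy sz] := outer_end hP ip sD.
have [tr ts rs] := edge_neq trs.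
have i_out u v : u \in outer h i -> v \in h i.-1 -> u != v.
  move=> ui; apply: contraTneq => <-; apply: (outer_below hP _ _ ui) => //.
  by rewrite prednK.
have th : t \in h i.-1 by rewrite hpE !inE eqxx.
have sh := outer_sub sD.
have pt := i_out _ _ pi th; have qt := i_out _ _ qi th.
have ps := i_out _ _ pi sh; have qs := i_out _ _ qi sh.
have ty : t != y by apply: contraTneq th => ->; apply: (end_free_notin hP).
have tz : t != z by apply: contraTneq th => ->; apply: (end_free_notin (end_swap hP)).
have [d dB dD] : exists2 d, d \in others y z x & d \in outer h i.-1.
  have [BD|] := boolP [disjoint others y z x & outer h i.-1]; last first.
    by case/pred0Pn=> d /= /andP[dB di]; exists d.
  have ik1 : i.-1 < k by case/andP: ip.
  (* i - 1 takes the place of i among the spurs, to the same count *)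
  pose I' := Ordinal ik1 |: (spurs h y :\ i).
  have i'I : Ordinal ik1 \notin spurs h y :\ i.
    rewrite inE negb_and; apply/orP; right; apply/negP=> /imin /=.
    by rewrite leqNgt prednK ?leqnn.
  have cI' : #|I'| = #|spurs h y| by rewrite cardsU1 i'I (cardsD1 i (spurs h y)) iI.
  suff : #|others y z x| + 2 * #|I'| <= n - 3
    by rewrite cI'; move: deg A1 I_gt0 n_ge10; clear; lia.
  apply: (count_outer hP) => // j; rewrite !in_setU1 => /orP[/eqP->|].
    by split=> //; case/andP: ip.
  rewrite in_setD1 => /andP[ji jI].
  split; first by move: jI; rewrite inE => /andP[].
  apply: (spurs_above_disjoint hP iI).
  by rewrite ltn_neqAle imin // andbT eq_sym.
have /andP[_ yzd] : (d != x) && edge y z d by move: dB; rewrite inE.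
have [t' [d' [_ oD _ /edge_neq[_ _ dd']]]] := outer_triple hP ip dD.
have d'D : d' \in outer h i.-1 by rewrite oD !inE eqxx orbT.
have [_ dy dz] := outer_end hP ip dD; have [_ d'y d'z] := outer_end hP ip d'D.
have pd := i_out _ _ pi (outer_sub dD); have pd' := i_out _ _ pi (outer_sub d'D).
have qd := i_out _ _ qi (outer_sub dD); have qd' := i_out _ _ qi (outer_sub d'D).
have rsd b : edge r s b -> edge b d d'.
  by rewrite /edge setUC -opE oD setUA.
(* others r s t misses at most two vertices outside {r, s, t} *)
have [b bB' bl] : exists2 b, b \in others r s t & b \in [:: y; z; p; q].
  have [/hasP[b bl bB']|/hasPn nob] := boolP (has (mem (others r s t)) [:: y; z; p; q]).
    by exists b.
  suff : #|others r s t| + size [:: r; s; t; y; z; p; q] <= n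
    by move: B'n n_ge10 => /=; clear; lia.
  apply: card_avoiding; first by distinct.
  move=> b; rewrite (mem_cat _ [:: r; s; t]) => /orP[|/nob //].
  rewrite !inE negb_and => /or3P[]/eqP->; rewrite ?eqxx ?orbT //.
    by apply/orP; right; apply/negP=> /edge_neq[_]; rewrite eqxx.
  by apply/orP; right; apply/negP=> /edge_neq[_ _]; rewrite eqxx.
move: bB'; rewrite inE => /andP[_ rsb].
have prq : edge p r q by rewrite edge_swap12.
have rbs : edge r b s by rewrite edge_swap23.
have bdd' := rsd b rsb.
move: bl; rewrite !inE => /or4P[]/eqP eb; subst b.
- have pyz : edge p y z by rewrite edge_swap12 edge_swap23.
  by apply: (no_triangle prq rbs pyz); distinct.
- have pzy : edge p z y by rewrite edge_swap12 edge_swap23 edge_swap12.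
  by apply: (no_triangle prq rbs pzy); distinct.
- have ydz : edge y d z by rewrite edge_swap23.
  by apply: (no_triangle ypq bdd' ydz); distinct.
- have ydz : edge y d z by rewrite edge_swap23.
  have yqp : edge y q p by rewrite edge_swap23.
  by apply: (no_triangle yqp bdd' ydz); distinct.
Qed.

Definition new_end h e j := if j is 0 then e : {set V} else h j.

(** Without spurs, deg y <= 1 + |A| + |B| with |B| <= n - 3: an empty A (or C,
    by the same count at z) is impossible, and |A| = 1 requires |B| = n - 3. *)
Lemma path_end_structure h x y z : path_end h k x y z ->
  [/\ forall f, f \in E -> y \in f -> (x \in f) || (z \in f),
      forall b, b \notin [set x; y; z] -> edge y z b &
      exists w, others x y z = [set w]].
Proof.
move=> hP; have hP' := end_swap hP; have xyz := end_edge hP.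
have deg := degree_bound hP; have deg' := degree_bound hP'.
have Bxyz : [disjoint others y z x & [set x; y; z]]
  by rewrite -setUA setUC others_disjoint.
have B3 : #|others y z x| <= n - 3.
  by rewrite -(setC_triple xyz) subset_leq_card // -disjoints_subset.
have [A0|C0|[w [A1 C1]]] := others_trichotomy hP.
- by move: deg; rewrite (spurs_empty hP) A0 !cards0; move: B3 n_ge10; clear; lia.
- move: deg'; rewrite (othersC z y) (spurs_empty hP') C0 !cards0 //.
  by move: B3 n_ge10; clear; lia.
have I0 : spurs h y = set0 by apply: (spurs_empty hP); rewrite A1 cards1.
split; last by exists w.
- move=> f fE yf; have [//|xf] := boolP (x \in f); have [//|zf /=] := boolP (z \in f).
  have [i /andP[i0 ik] fi] := edge_at_free_vertex hP fE yf xf zf.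
  have : Ordinal ik \in spurs h y by rewrite inE /= i0 -fi.
  by rewrite I0 inE.
- move=> b; rewrite -setUA setUC => bN; apply: others_full bN.
    by rewrite edge_swap23 edge_swap12.
  by move: deg n_ge10; rewrite I0 A1 cards1 cards0; clear; lia.
Qed.

(** The second path provides an edge {x', y, w} with w <> z; being an edge at y
    it meets {x, z} by path_end_structure for the first path, so w = x, and
    {x, y, x'} is that edge. *)
Lemma attach_in_others h h' x x' y z : path_end h k x y z -> path_end h' k x' y z ->
  x' != x -> x' \in others x y z.
Proof.
move=> hP hP' xx; have [no_spur _ _] := path_end_structure hP.
have [_ _ [w wE]] := path_end_structure hP'.
have : w \in others x' y z by rewrite wE inE.
rewrite inE => /andP[wz xyw].
have [x'y _ _] := edge_neq (end_edge hP'); have [_ x'z _] := edge_neq (end_edge hP').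
have [xy xz yz] := edge_neq (end_edge hP).
have xw : x = w.
  have /orP[] : (x \in [set x'; y; w]) || (z \in [set x'; y; w]).
    by apply: no_spur xyw _; rewrite !inE eqxx orbT.
    by rewrite !inE (eq_sym x) (negbTE xx) (negbTE xy) => /eqP.
  by rewrite !inE !(eq_sym z) (negbTE x'z) (negbTE yz) (negbTE wz).
by rewrite inE x'z edge_swap12 edge_swap23 edge_swap12 xw.
Qed.

Lemma fresh (l : seq V) : size l < n -> exists b, b \notin l.
Proof.
move=> ln; have [b bl|all_l] := pickP (fun b => b \notin l); first by exists b.
have sub : V \subset l by apply/subsetP=> b _; exact: negbFE (all_l b).
have := leq_trans ln (leq_trans (subset_leq_card sub) (card_size l)).
by rewrite ltnn.
Qed.

Lemma triple_meet1 (a b c : V) (X : {set V}) : a \in X -> b \notin X -> c \notin X ->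
  #|[set a; b; c] :&: X| = 1.
Proof.
move=> aX bX cX; apply: (@card_singleton _ a); apply/setP=> u; rewrite !inE.
have [->//|_] := eqVneq u a; rewrite /=; apply/negbTE/negP=> /andP[/orP[]/eqP->].
  exact/negP.
exact/negP.
Qed.

Lemma triple_meet0 (a b c : V) (X : {set V}) : a \notin X -> b \notin X -> c \notin X ->
  #|[set a; b; c] :&: X| = 0.
Proof.
move=> aX bX cX; apply/eqP; rewrite cards_eq0; apply/eqP/setP=> u; rewrite !inE.
by apply/negbTE/negP=> /andP[/orP[/orP[]|]/eqP->]; apply/negP.
Qed.

Lemma new_end_path h x y z v : path_end h k x y z -> 1 < k -> v \in h 1 ->
  (2 < k -> v \notin h 2) -> edge v y z ->
  path_end (new_end h [set v; y; z]) k v y z.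
Proof.
move=> hP k1 v1 v2 vyz; have [[hE hI] k0 h0 x1] := hP.
have lh : linear_path h k by [].
split=> //; split; first by case=> [|j] jk //=; apply: hE.
case=> [|i] [|j] // ijk; last by rewrite /= hI.
have y_out := end_free_notin hP ijk; have z_out := end_free_notin (end_swap hP) ijk.
case: j ijk y_out z_out => [|j] /= ijk y_out z_out; first by rewrite triple_meet1.
rewrite triple_meet0 //; case: j ijk {y_out z_out} => [|j] ijk; first exact: v2.
by apply/negP=> vj; have := path_meet lh ijk k1 vj v1.
Qed.

(** The pair yz forms an edge with every vertex, so a vertex v of outer h 1 that
    is not in h 2 can replace x in the end edge; by attach_in_others it equals
    the w with others x y z = {w}.  For k = 2 this applies to both vertices of outer h 1.  For k > 2 it
    applies to one of them, r, and the joint s of h 1 and h 2 is dealt with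
    by two further longest paths: {y, x, r}, {s, y, z}, h 2, ... shows that xr
    forms an edge with every vertex, in particular with some p in outer h k.-1,
    and then {s, y, z}, h 2, ..., h k.-1, {p, x, r} forces s = w = r.
    For k = 1 the attaching vertex is arbitrary, and choosing y
    instead of x makes others x z y both large and a singleton. *)
Lemma no_longest_path h : 0 < k -> ~ linear_path h k.
Proof.
move=> k0 lh; have [hE hI] := lh.
have [x [y [z hP]]] : exists x y z, path_end h k x y z.
  have [k1|k1] := ltnP 1 k.
    have [x xE] := path_joint lh k1; have := set11 x; rewrite -xE => /setIP[x0 x1].
    by have [y [z [h0 _]]] := edgeP (hE 0 k0) x0; exists x, y, z.
  have /card_gt0P[x x0] : 0 < #|h 0| by rewrite (hyperedges_card (hE 0 k0)).
  have [y [z [h0 _]]] := edgeP (hE 0 k0) x0; exists x, y, z; split=> //.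
  by rewrite ltnNge k1.
have xyz := end_edge hP; have [xy xz yz] := edge_neq xyz.
have [_ Bfull [w wE]] := path_end_structure hP.
have [k1|k1] := ltnP 1 k; last first.
  have hP' : path_end h k y x z.
    by case: hP => _ _ h0 _; split=> //; [rewrite h0 (setUC [set x])|rewrite ltnNge k1].
  have [_ B'full _] := path_end_structure hP'.
  have [_ _ [w' w'E]] := path_end_structure (end_swap hP).
  have [b] : exists b, b \notin [:: x; y; z; w'].
    by apply: fresh; apply: leq_trans n_ge10.
  rewrite !inE !negb_or => /and4P[bx b_y bz bw'].
  have : b \in others x z y by rewrite inE b_y B'full // !inE !negb_or bx b_y bz.
  by rewrite w'E inE (negbTE bw').
have in_w h' v : path_end h' k v y z -> v != x -> v = w.
  by move=> hP' vx; apply/set1P; rewrite -wE; apply: attach_in_others hP hP' vx.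
have free_w v : v \in outer h 1 -> (2 < k -> v \notin h 2) -> v = w.
  move=> vo v2; have [vx vy vz] := outer_end hP (i := 1) k1 vo.
  apply: (in_w (new_end h [set v; y; z])) => //.
  apply: (new_end_path hP k1 (outer_sub vo) v2).
  by rewrite edge_swap12 edge_swap23 Bfull // !inE !negb_or vx vy vz.
have [k2|k2] := ltnP 2 k; last first.
  have one : #|outer h 1| <= #|[set w]|.
    apply: subset_leq_card; apply/subsetP=> v vo; rewrite inE (free_w v vo) //.
    by rewrite ltnNge k2.
  by move: one; rewrite (card_outer hP) ?cards1.
have [s sE] := path_joint lh k2; have := set11 s; rewrite -sE => /setIP[s1 s2].
have so : s \in outer h 1 by apply: (joint_outer hP).
have [t [r [_ oE _ /edge_neq[_ _ sr]]]] := outer_triple hP (i := 1) k1 so.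
have ro : r \in outer h 1 by rewrite oE !inE eqxx orbT.
have r2 : r \notin h 2.
  apply: contra sr => r2; rewrite eq_sym -in_set1 -sE inE r2 andbT.
  exact: outer_sub ro.
have rw : r = w by apply: free_w.
have [rx ry rz] := outer_end hP (i := 1) k1 ro.
have [sx sy sz] := outer_end hP (i := 1) k1 so.
have xyr : edge x y r by have := set11 w; rewrite -wE -rw inE => /andP[].
have syz : edge s y z by rewrite edge_swap12 edge_swap23 Bfull // !inE !negb_or sx sy sz.
have x_out j : 1 < j < k -> x \notin h j := end_attach_notin hP (i := j).
have y_out j : 0 < j < k -> y \notin h j := end_free_notin hP (i := j).
have z_out j : 0 < j < k -> z \notin h j := end_free_notin (end_swap hP) (i := j).
have r_out j : 1 < j < k -> r \notin h j.
  case/andP; rewrite leq_eqVlt => /orP[/eqP<- //|j2 jk].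
  apply/negP=> rj; have := path_meet lh jk k1 rj (outer_sub ro).
  by rewrite leqNgt j2.
have s_out j : 2 < j < k -> s \notin h j.
  case/andP=> j2 jk; apply/negP=> sj; have := path_meet lh jk k1 sj s1.
  by rewrite leqNgt j2.
pose g j := match j with 0 => [set y; x; r] | 1 => [set s; y; z] | _ => h j end.
have gP : path_end g k y x r.
  split=> //; last by rewrite /g !inE eqxx orbT.
  split.
    case=> [|[|j]] jk //=; last exact: hE.
    by rewrite -[_ \in _]/(edge y x r) edge_swap12.
  case=> [|[|i]] [|[|j]] // ijk; rewrite /=.
  - by rewrite triple_meet1 // ?inE ?eqxx ?orbT //; distinct.
  - by rewrite triple_meet0 ?y_out ?x_out ?r_out.
  - case: j ijk => [|j] ijk; first by rewrite triple_meet1 ?y_out ?z_out.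
    by rewrite triple_meet0 ?y_out ?z_out ?s_out.
  - by rewrite hI.
have [_ xr_full _] := path_end_structure gP.
have kp : 1 < k.-1 < k by case: (k) k2 => // k'; rewrite ltnS /= => ->; rewrite ltnSn.
have kp0 : 0 < k.-1 < k by case/andP: kp => /ltnW-> ->.
have /card_gt0P[p po] : 0 < #|outer h k.-1| by rewrite (card_outer hP).
have [px py pz] := outer_end hP kp0 po.
have ph := outer_sub po.
have pr : p != r by apply: contraTneq ph => ->; apply: r_out.
have p_below j : j < k.-1 -> p \notin h j.
  by move=> jk; apply: (outer_below hP _ jk po); case/andP: kp.
have ps : p != s by apply: contraTneq s1 => <-; apply: p_below; case/andP: kp.
have pxr : edge p x r.
  by rewrite edge_swap12 edge_swap23 xr_full // !inE !negb_or px py pr.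
pose g' j := if j == 0 then [set s; y; z] else
  if j == k.-1 then [set p; x; r] else h j.+1.
have g'P : path_end g' k s y z.
  split=> //; last first.
    rewrite /g' /= => _; case: eqP => // k1E; by move: kp; rewrite -k1E.
  split=> [j jk|i j /andP[ij jk]]; rewrite /g'.
    case: eqP => // _; case: ifP => // /negbT jk'; apply: hE.
    by move: jk jk'; clear; lia.
  have j0 : (j == 0) = false by move: ij; clear; lia.
  rewrite j0; have [->|i0] := eqVneq i 0.
    have [ej|jp] := eqVneq j k.-1.
      rewrite (_ : j == 1 = false); last by move: kp; rewrite -ej; clear; lia.
      by rewrite triple_meet0 //; distinct.
    have jk1 : 1 < j.+1 < k by move: ij jk jp; clear; lia.
    have jk2 : 0 < j.+1 < k by case/andP: jk1 => /ltnW-> ->.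
    have [->|j1] := eqVneq j 1; first by rewrite triple_meet1 ?y_out ?z_out.
    rewrite triple_meet0 ?y_out ?z_out ?s_out //.
    by move: jk1 j1; clear; lia.
  have ik : (i == k.-1) = false by move: ij jk; clear; lia.
  rewrite ik; have [ej|jp] := eqVneq j k.-1; last first.
    by rewrite hI ?eqSS //; move: ij jk jp; clear; lia.
  have ik1 : 1 < i.+1 < k by move: ij jk i0; clear; lia.
  rewrite setIC; have [eji|nji] := eqVneq j i.+1.
    by rewrite triple_meet1 ?x_out ?r_out // -eji ej.
  rewrite triple_meet0 ?x_out ?r_out // p_below //.
  by move: ij ej nji; clear; lia.
have sw : s = w := in_w _ _ g'P sx.
by move: sr; rewrite sw rw eqxx.
Qed.

End Longest.

Lemma linear_path_size h k : linear_path h k -> k <= #|E|.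
Proof.
move=> [hE hI]; have h_inj : injective (fun i : 'I_k => h i).
  have neq (i j : 'I_k) : i < j -> h i <> h j.
    move=> ij eij; have := hI i j; rewrite ij ltn_ord => /(_ isT).
    by rewrite -eij setIid (hyperedges_card (hE i (ltn_ord i))); case: (_ == _).
  move=> i j eij; apply/val_inj; case: (ltngtP i j) => // /neq; first by case.
  by case; rewrite eij.
rewrite -[k]card_ord -cardsT -(card_imset _ h_inj); apply: subset_leq_card.
by apply/subsetP=> _ /imsetP[i _ ->]; apply: hE.
Qed.

(** The length of a path is at most the number of edges; descending from there,
    no_longest_path excludes every positive length, even length 1. *)
Lemma min_degree_lt : 10 <= n -> ~ (forall v, n - 1 <= degree H v).
Proof.
move=> n10 deg.
have no_paths m : forall k h, #|E| < k + m -> 0 < k -> ~ linear_path h k.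
  elim: m => [|m IHm] k h.
    by rewrite addn0 ltnNge => /negP Ek _ /linear_path_size.
  rewrite addnS -addSn => Ek; apply: no_longest_path n10 deg _ => h'.
  exact: IHm.
have /card_gt0P[v _] : 0 < n by apply: leq_trans n10.
have /card_gt0P[e] : 0 < degree H v.
  by apply: leq_trans (deg v); move: n10; clear; lia.
rewrite inE => /andP[eE _]; apply: (no_paths #|E| 1 (fun=> e)) => //.
by split=> // i j; rewrite ltnS leqn0 => /andP[+ /eqP j0]; rewrite j0.
Qed.

End LinearCycleFree.

Theorem theorem5 (V : finType) (H : hypergraph3 V) :
  10 <= #|V| -> ~ has_linear_cycle H ->
  exists x : V, degree H x <= #|V| - 2.
Proof.
move=> n10 acyclic; have [x|none] := pickP (fun x => degree H x <= #|V| - 2).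
  by exists x.
case: (min_degree_lt acyclic n10) => v.
by have := none v; rewrite leqNgt => /negbFE; move: n10; clear; lia.
Qed.
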